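(* Let $G$ be the group of order 16 given by the presentation $$ G=\langle X,Y,Z \mid Z^4=Y^4=X^2=1,\; XZ=Z^{-1}X,\; Z^2=Y^2,\; XY=YX,\; ZY=YZ\rangle $$ (SmallGroup(16,13)), and let $\mathcal{S}(G)=\{\mathcal{D}_G(\alpha) : \alpha\in\mathbb{Z}[G]\}\subseteq\mathbb{Z}$ be its set of integer group determinants. Then: (1) The even elements of $\mathcal{S}(G)$ are exactly the integer multiples of $2^{16}$. (2) The odd elements of $\mathcal{S}(G)$ are exactly all the integers $n\equiv 1 \pmod{16}$, together with those integers $n\equiv 9\pmod{16}$ that are divisible by at least one prime $p$ with $p\equiv \pm 3$ or $\pm 5 \pmod{16}$.
   Context: For a finite group $G$ and an element $\sum_{g\in G} a_g g$ of the integral group ring $\mathbb{Z}[G]$ (so $a_g\in\mathbb{Z}$), the integer group determinant is $$\mathcal{D}_G\Big(\sum_{g\in G} a_g g\Big):=\det\big(a_{gh^{-1}}\big)_{g,h\in G},$$ the determinant of the $|G|\times|G|$ matrix with rows and columns indexed by the elements of $G$ (in the same order). The integer group determinants of $G$ are all the integers (positive, negative or zero) obtained as $\mathcal{D}_G(\alpha)$ with $\alpha\in\mathbb{Z}[G]$. The name SmallGroup(16,13) refers to GAP's small group library; this group is the central product of the dihedral group of order eight $\langle X,Z\rangle$ and the cyclic group of order four $\langle Y\rangle$ over a common central subgroup of order two. *)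

(* Defs.v *)
From mathcomp Require Import all_boot all_order all_algebra all_fingroup.
From mathcomp Require Import all_solvable.

Set Implicit Arguments.
Unset Strict Implicit.
Unset Printing Implicit Defensive.

Import GRing.Theory.
Local Open Scope ring_scope.

(* The element \sum_g a_g g of Z[G] is given by its coefficients a : G -> int;
   rows and columns are both indexed by the enumeration of G. *)
Definition group_det (G : finGroupType) (a : {ffun G -> int}) : int :=
  \det (\matrix_(i < #|G|, j < #|G|) a (enum_val i * (enum_val j)^-1)%g).

Definition is_group_det (G : finGroupType) (n : int) : Prop :=
  exists a : {ffun G -> int}, group_det a = n.

(* Main.v *)
(* The elements 1, X, Z, ZX and their multiples by Y represent the cosets of the
   central subgroup {1, Z^2}.  For alpha in Z[G], let c and e be the images of
   alpha under Z^2 |-> 1 and Z^2 |-> -1, written on these eight representatives;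
   they agree mod 2.  The determinant factors as the product of the values of
   the eight characters of (Z/2)^3 at c and the square of the norm N from Z[i]
   of the reduced norm A^2 - B^2 + C^2 - D^2 of the quaternion algebra over Q(i)
   in which e lives.

   If the determinant is even, so are all character values.  The map sending a
   character to the parity of the sum of c over the elements where it is -1 is
   linear; if it is nonzero then four character values are divisible by 4, and
   otherwise c mod 2 is an affine function, which makes the reduced norm
   divisible by 4.

   If the determinant is odd, it is 1 mod 8.  If moreover it has no prime factor
   3 or 5 mod 8 then all its divisors are +1 or -1 mod 8; for N this forces the
   imaginary part of the reduced norm to be divisible by 4, and comparing the
   squares of the character values mod 32 gives 1 mod 16. *)
Require Import Defs.
From mathcomp Require Import all_boot all_order all_algebra all_fingroup.
From mathcomp Require Import all_solvable all_field.
From mathcomp Require Import zify ring.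
From HB Require Import structures.

Set Implicit Arguments.
Unset Strict Implicit.
Unset Printing Implicit Defensive.

Import Order.TTheory GRing.Theory Num.Theory.
Local Open Scope ring_scope.

(** * Determinants indexed by finite types *)

Definition detf (R : comNzRingType) (T : finType) (F : T -> T -> R) : R :=
  \det (\matrix_(i < #|T|, j < #|T|) F (enum_val i) (enum_val j)).

(** Rows and columns are permuted alike, so the two signs cancel. *)
Lemma detf_reindex (R : comNzRingType) (T : finType) (F : T -> T -> R) n
    (h : 'I_n -> T) :
  bijective h -> detf F = \det (\matrix_(i < n, j < n) F (h i) (h j)).
Proof.
move=> hbij; have En : #|T| = n by rewrite -(bij_eq_card hbij) card_ord.
subst n; have sinj : injective (fun i => enum_rank (h i)).
  by move=> i j /enum_rank_inj /(bij_inj hbij).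
have -> : \matrix_(i < #|T|, j < #|T|) F (h i) (h j) =
    row_perm (perm sinj) (col_perm (perm sinj)
      (\matrix_(i < #|T|, j < #|T|) F (enum_val i) (enum_val j))).
  by apply/matrixP=> i j; rewrite !mxE !permE !enum_rankK.
rewrite row_permE col_permE !det_mulmx !det_perm odd_permV.
by rewrite mulrCA -expr2 sqrr_sign mulr1.
Qed.

Lemma detf_bij (R : comNzRingType) (T U : finType) (F : U -> U -> R)
    (h : T -> U) :
  bijective h -> detf F = detf (fun x y => F (h x) (h y)).
Proof.
move=> hbij; apply: (@detf_reindex R U F #|T| (h \o enum_val)).
by apply: bij_comp hbij _; apply: enum_val_bij.
Qed.

Lemma eq_detf (R : comNzRingType) (T : finType) (F1 F2 : T -> T -> R) :
  F1 =2 F2 -> detf F1 = detf F2.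
Proof.
by move=> eqF; congr (\det _); apply/matrixP=> i j; rewrite !mxE eqF.
Qed.

Lemma detf_rmorph (R S : comNzRingType) (f : {rmorphism R -> S}) (T : finType)
    (F : T -> T -> R) :
  f (detf F) = detf (fun x y => f (F x y)).
Proof.
by rewrite -det_map_mx; congr (\det _); apply/matrixP=> i j; rewrite !mxE.
Qed.

(** Conjugation by a unipotent block matrix with corner [w] makes the matrix block lower
    triangular. *)
Lemma det_block_twist (R : comNzRingType) n (P Q : 'M[R]_n) (w : R) :
  \det (block_mx P ((w ^+ 2) *: Q) Q P) =
  \det (P + w *: Q) * \det (P - w *: Q).
Proof.
set A := block_mx P _ Q P.
have := det_mulmx (block_mx 1%:M (w%:M) 0 1%:M) A.
rewrite det_ublock !det1 !mul1r => <-.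
have := det_mulmx (block_mx 1%:M (w%:M) 0 1%:M *m A)
  (block_mx 1%:M (- w%:M) 0 1%:M).
rewrite det_ublock !det1 !mulr1 => <-.
rewrite -(det_lblock _ Q) !mulmx_block !mul0mx !mulmx0 !mul1mx !mulmx1.
congr (\det _); congr block_mx; rewrite ?add0r ?addr0 ?mul_scalar_mx //.
- rewrite mulmxN mul_mx_scalar scalerDr scalerA -expr2.
  by rewrite [X in - X]addrC addNr.
- by rewrite mulmxN mul_mx_scalar addrC.
Qed.

Definition bpair (T : finType) (x : 'I_#|T| + 'I_#|T|) : bool * T :=
  match x with inl i => (false, enum_val i) | inr i => (true, enum_val i) end.

Lemma bpair_bij (T : finType) : bijective (@bpair T).
Proof.
exists (fun y => if y.1 then inr (enum_rank y.2) else inl (enum_rank y.2)).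
  by case=> i /=; rewrite enum_valK.
by case=> [[] x] /=; rewrite enum_rankK.
Qed.

(** [w] is the value given to the element that the Boolean stands for: 1 for an involution, i for Y
    when Y^2 = -1. *)
Lemma detf_twist (R : comNzRingType) (T : finType) (w : R)
    (F : bool * T -> bool * T -> R) (P Q : T -> T -> R) :
    (forall x y, F (false, x) (false, y) = P x y) ->
    (forall x y, F (false, x) (true, y) = w ^+ 2 * Q x y) ->
    (forall x y, F (true, x) (false, y) = Q x y) ->
    (forall x y, F (true, x) (true, y) = P x y) ->
  detf F = detf (fun x y => P x y + w * Q x y)
         * detf (fun x y => P x y - w * Q x y).
Proof.
move=> F00 F01 F10 F11.
rewrite (@detf_reindex R _ F (#|T| + #|T|) (fun i => bpair (split i)));
  last first.
  apply: bij_comp (bpair_bij T) _.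
  by exists (@unsplit _ _); [apply: splitK | apply: unsplitK].
pose M (A : T -> T -> R) : 'M[R]_#|T| :=
  \matrix_(i, j) A (enum_val i) (enum_val j).
have -> : \matrix_(i, j) F (bpair (split i)) (bpair (split j)) =
          block_mx (M P) (w ^+ 2 *: M Q) (M Q) (M P).
  apply/matrixP=> i j; rewrite !mxE.
  case: (split i) => i' /=; rewrite !mxE;
    by case: (split j) => j' /=; rewrite !mxE.
rewrite det_block_twist /detf; congr (_ * _); congr (\det _);
  by apply/matrixP=> i j; rewrite !mxE.
Qed.

(** * A model of the group on four bits *)

(** The Pauli group in normal form. The conjunctions in [pauli_mul] are the carries from Y Y = Y^2,
    Z Z = Y^2 and X Z = Y^2 Z X. *)
Definition pauli : Type := bool * (bool * (bool * bool)).
HB.instance Definition _ := Finite.on pauli.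

(* (p, (q, (r, s))) encodes Y^(2p) Y^q Z^r X^s. *)
Definition pauli_mul (g h : pauli) : pauli :=
  let: (p1, (q1, (r1, s1))) := g in let: (p2, (q2, (r2, s2))) := h in
  (p1 (+) p2 (+) (q1 && q2) (+) (r1 && r2) (+) (s1 && r2),
   (q1 (+) q2, (r1 (+) r2, s1 (+) s2))).

Definition pauli_inv (g : pauli) : pauli :=
  let: (p, (q, (r, s))) := g in (p (+) q (+) r (+) (s && r), (q, (r, s))).

Fact pauli_mulA : associative pauli_mul.
Proof.
move=> [p1 [q1 [r1 s1]]] [p2 [q2 [r2 s2]]] [p3 [q3 [r3 s3]]].
congr (_, (_, (_, _))); rewrite ?addbA //.
case: p1 q1 r1 s1 => [] [] [] []; case: p2 q2 r2 s2 => [] [] [] [];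
  by case: p3 q3 r3 s3 => [] [] [] [].
Qed.

Fact pauli_mul1 : left_id (false, (false, (false, false))) pauli_mul.
Proof. by case=> [p [q [r s]]] /=; rewrite !addbF. Qed.

Fact pauli_mulV :
  left_inverse (false, (false, (false, false))) pauli_inv pauli_mul.
Proof. by case=> [[] [[] [[] []]]]. Qed.

HB.instance Definition _ :=
  Finite_isGroup.Build pauli pauli_mulA pauli_mul1 pauli_mulV.

Definition pauli_eval (gT : finGroupType) (x y z : gT) (g : pauli) : gT :=
  let: (p, (q, (r, s))) := g in
  ((y ^+ 2) ^+ p * y ^+ q * z ^+ r * x ^+ s)%g.

Lemma pauli_evalM (gT : finGroupType) (x y z : gT) :
    (y ^+ 4 = 1 -> x ^+ 2 = 1 -> x * z = z^-1 * x -> z ^+ 2 = y ^+ 2 ->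
     x * y = y * x -> z * y = y * z ->
     {morph pauli_eval x y z : g h / g * h})%g.
Proof.
move=> y4 x2 xz zy xyC zyC.
(* Each rule has two forms, for the end of a word and before a tail [u], as words are associated to
   the right. *)
have yy : ((y * (y * (y * y)) = 1)%g *
           (forall u, y * (y * (y * (y * u))) = u)%g)%type.
  have yyyy : (y * (y * (y * y)) = 1)%g by rewrite -y4 !expgS expg0 mulg1.
  by split=> // u; rewrite -[RHS]mul1g -[in RHS]yyyy -!mulgA.
have zz : ((z * z = y * y)%g * (forall u, z * (z * u) = y * (y * u))%g)%type.
  have zzyy : (z * z = y * y)%g by move: zy; rewrite !expgS !expg0 !mulg1.
  by split=> // u; rewrite !mulgA zzyy.
have xx : ((x * x = 1)%g * (forall u, x * (x * u) = u)%g)%type.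
  have xx1 : (x * x = 1)%g by rewrite -x2 !expgS expg0 mulg1.
  by split=> // u; rewrite mulgA xx1 mul1g.
have zy' u : (z * (y * u) = y * (z * u))%g by rewrite !mulgA zyC.
have xy' u : (x * (y * u) = y * (x * u))%g by rewrite !mulgA xyC.
have xz' : ((x * z = y * (y * (z * x)))%g *
            (forall u, x * (z * u) = y * (y * (z * (x * u))))%g)%type.
  have xzE : (x * z = y * (y * (z * x)))%g.
    rewrite xz; apply: (mulgI z); rewrite mulKVg.
    by rewrite !zy' zz yy.
  by split=> // u; rewrite mulgA xzE !mulgA.
move=> [p1 [q1 [r1 s1]]] [p2 [q2 [r2 s2]]]; rewrite /pauli_eval.
case: p1 q1 r1 s1 p2 q2 r2 s2 => [] [] [] [] [] [] [] [];
  rewrite /= ?expgS ?expg0 ?mulg1 ?mul1g -?mulgA;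
  by rewrite ?(yy, zz, xx, zyC, zy', xyC, xy', xz', mulg1, mul1g).
Qed.

(** * Determinants of (Z/2)^3 and of the quaternion algebra *)

(* Laplace expansion along the first two rows. *)
Lemma det_mx44 (R : comNzRingType) (N : nat -> nat -> R) :
  let m i j k l : R := N i k * N j l - N i l * N j k in
  \det (\matrix_(i < 4, j < 4) N i j) =
    m 0%N 1%N 0%N 1%N * m 2%N 3%N 2%N 3%N
  - m 0%N 1%N 0%N 2%N * m 2%N 3%N 1%N 3%N
  + m 0%N 1%N 0%N 3%N * m 2%N 3%N 1%N 2%N
  + m 0%N 1%N 1%N 2%N * m 2%N 3%N 0%N 3%N
  - m 0%N 1%N 1%N 3%N * m 2%N 3%N 0%N 2%N
  + m 0%N 1%N 2%N 3%N * m 2%N 3%N 0%N 1%N.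
Proof.
move=> m; rewrite /m {m}.
do 3 rewrite !(expand_det_row _ ord0) !big_ord_recl !big_ord0 /cofactor.
by rewrite !det_mx11 !mxE /= /bump /=; ring.
Qed.

Definition b00 := (false, false).
Definition b01 := (false, true).
Definition b10 := (true, false).
Definition b11 := (true, true).

Lemma detf_bool2 (R : comNzRingType) (F : bool * bool -> bool * bool -> R) :
  let m x y u v : R := F x u * F y v - F x v * F y u in
  detf F = m b00 b01 b00 b01 * m b10 b11 b10 b11
         - m b00 b01 b00 b10 * m b10 b11 b01 b11
         + m b00 b01 b00 b11 * m b10 b11 b01 b10
         + m b00 b01 b01 b10 * m b10 b11 b00 b11
         - m b00 b01 b01 b11 * m b10 b11 b00 b10
         + m b00 b01 b10 b11 * m b10 b11 b00 b01.
Proof.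
pose h (i : nat) := ((1 < i)%N, odd i).
rewrite (@detf_reindex R _ F 4 h) ?(det_mx44 (fun i j => F (h i) (h j))) //.
exists (fun b : bool * bool => inord (b.1.*2 + b.2)).
  by case=> [[|[|[|[|i]]]] lt_i4] //; apply/val_inj; rewrite /= inordK.
by case=> [[] []]; rewrite /h inordK.
Qed.

(** The product of the values of the four characters of (Z/2)^2. *)
Definition v4det (p : bool -> bool -> int) : int :=
    (p false false + p false true + p true false + p true true)
  * (p false false - p false true + p true false - p true true)
  * (p false false + p false true - p true false - p true true)
  * (p false false - p false true - p true false + p true true).

Lemma detf_v4 (p : bool -> bool -> int) :
  detf (fun x y : bool * bool => p (x.1 (+) y.1) (x.2 (+) y.2)) = v4det p.
Proof. by rewrite detf_bool2 /v4det /=; ring. Qed.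

Definition c2cube_det (c : bool -> bool -> bool -> int) : int :=
  v4det (fun r s => c false r s + c true r s)
  * v4det (fun r s => c false r s - c true r s).

Lemma detf_c2cube (c : bool -> bool -> bool -> int) :
  detf (fun x y : bool * (bool * bool) =>
    c (x.1 (+) y.1) (x.2.1 (+) y.2.1) (x.2.2 (+) y.2.2)) = c2cube_det c.
Proof.
pose S b (x y : bool * bool) : int := c b (x.1 (+) y.1) (x.2 (+) y.2).
rewrite (@detf_twist _ _ 1 _ (S false) (S true)) ?expr1n //;
  last by move=> x y; rewrite mul1r.
rewrite /c2cube_det -!detf_v4; congr (_ * _); apply: eq_detf => x y;
  by rewrite /= mul1r.
Qed.

(* With i the image of Y, e stands for A + B X + C Z + D ZX with coefficients in
   Z[i] (so A = e 0 0 0 + i e 1 0 0, and so on); re_nrd and im_nrd are the real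
   and imaginary parts of its reduced norm A^2 - B^2 + C^2 - D^2. *)
Definition re_nrd (e : bool -> bool -> bool -> int) : int :=
    (e false false false ^+ 2 - e true false false ^+ 2)
  - (e false false true ^+ 2 - e true false true ^+ 2)
  + (e false true false ^+ 2 - e true true false ^+ 2)
  - (e false true true ^+ 2 - e true true true ^+ 2).

Definition im_nrd (e : bool -> bool -> bool -> int) : int :=
    2 * (e false false false * e true false false
  - e false false true * e true false true
  + e false true false * e true true false
  - e false true true * e true true true).

Definition norm_nrd e : int := re_nrd e ^+ 2 + im_nrd e ^+ 2.

(* When Z^2 = -1, this is the sign of Z^r X^s (Z^r' X^s')^-1 relative to the
   basis element it is proportional to, for x = (r, s) and y = (r', s'). *)
Definition twist_sign (x y : bool * bool) : bool :=
  y.1 && (~~ y.2 (+) x.1 (+) x.2).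

(** This is the matrix of a multiplication in a quaternion algebra; its determinant is the square of
    the reduced norm. *)
Lemma detf_twisted_v4 (R : comNzRingType) (E : bool -> bool -> R) :
  detf (fun x y : bool * bool =>
    (-1) ^+ twist_sign x y * E (x.1 (+) y.1) (x.2 (+) y.2)) =
  (E false false ^+ 2 - E false true ^+ 2 + E true false ^+ 2
   - E true true ^+ 2) ^+ 2.
Proof. by rewrite detf_bool2 /twist_sign /=; ring. Qed.

Lemma detf_twisted (e : bool -> bool -> bool -> int) :
  detf (fun x y : bool * (bool * bool) =>
    (-1) ^+ ((~~ x.1 && y.1) (+) twist_sign x.2 y.2) *
    e (x.1 (+) y.1) (x.2.1 (+) y.2.1) (x.2.2 (+) y.2.2)) = norm_nrd e ^+ 2.
Proof.
(* Once i is available, the determinant splits into the squares of the reduced norm and of its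
   conjugate. *)
apply: (@intr_inj algC); rewrite (detf_rmorph intr).
pose S b (x y : bool * bool) : algC :=
  (-1) ^+ twist_sign x y * (e b (x.1 (+) y.1) (x.2 (+) y.2))%:~R.
rewrite (@detf_twist _ _ 'i _ (S false) (S true)) => [|x y|x y|x y|x y] /=;
  rewrite ?sqrCi ?rmorphM ?rmorph_sign ?signrN ?mulNr ?mul1r //.
have detE w : w ^+ 2 = -1 -> detf (fun x y => S false x y + w * S true x y) =
    ((re_nrd e)%:~R + w * (im_nrd e)%:~R) ^+ 2.
  move=> w2; pose E r s : algC := (e false r s)%:~R + w * (e true r s)%:~R.
  have -> : detf (fun x y => S false x y + w * S true x y) =
      detf (fun x y => (-1) ^+ twist_sign x y * E (x.1 (+) y.1) (x.2 (+) y.2)).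
    by apply: eq_detf => x y; rewrite /S /E; ring.
  rewrite detf_twisted_v4 /E /re_nrd /im_nrd !rmorphE /=; congr (_ ^+ 2).
  have sqE u v : (u + w * v) ^+ 2 = u ^+ 2 - v ^+ 2 + w * (2 * u * v).
    by rewrite sqrrD exprMn w2; ring.
  by rewrite !sqE; ring.
have -> : detf (fun x y => S false x y - 'i * S true x y) =
    ((re_nrd e)%:~R - 'i * (im_nrd e)%:~R) ^+ 2.
  rewrite -mulNr -detE ?sqrrN ?sqrCi //.
  by apply: eq_detf => x y; rewrite mulNr.
rewrite detE ?sqrCi // -exprMn [X in X ^+ 2]mulrC -subr_sqr.
by rewrite exprMn sqrCi mulN1r opprK /norm_nrd !rmorphE.
Qed.

(** * The determinant of the model and its transfer to [G] *)

Definition pauli_coef (a : pauli -> int) (p q r s : bool) : int :=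
  a (p, (q, (r, s))).

(** [lin_coef] and [spin_coef] give the images c and e, at Y^2 = 1 and Y^2 = -1. *)
Definition lin_coef a q r s :=
  pauli_coef a false q r s + pauli_coef a true q r s.
Definition spin_coef a q r s :=
  pauli_coef a false q r s - pauli_coef a true q r s.

Definition pauli_det (a : pauli -> int) : int :=
  c2cube_det (lin_coef a) * norm_nrd (spin_coef a) ^+ 2.

Lemma detf_pauli (a : pauli -> int) :
  detf (fun g h => a (pauli_mul g (pauli_inv h))) = pauli_det a.
Proof.
pose S b (x y : bool * (bool * bool)) : int :=
  a (pauli_mul (b, x) (pauli_inv (false, y))).
have S01 x y :
    a (pauli_mul (false, x) (pauli_inv (true, y))) = 1 ^+ 2 * S true x y.
  by rewrite expr1n mul1r; move: x y => [[] [[] []]] [[] [[] []]].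
have S11 x y : a (pauli_mul (true, x) (pauli_inv (true, y))) = S false x y.
  by move: x y => [[] [[] []]] [[] [[] []]].
rewrite (detf_twist (fun _ _ => erefl) S01 (fun _ _ => erefl) S11).
rewrite /pauli_det -detf_c2cube -detf_twisted; congr (_ * _); apply: eq_detf.
- move=> [q1 [r1 s1]] [q2 [r2 s2]]; rewrite mul1r /S.
  by case: q1 r1 s1 q2 r2 s2 => [] [] [] [] [] [] //=; rewrite addrC.
- move=> [q1 [r1 s1]] [q2 [r2 s2]]; rewrite mul1r /S.
  by case: q1 r1 s1 q2 r2 s2 => [] [] [] [] [] [];
    rewrite /spin_coef /pauli_coef /= ?mul1r ?mulN1r ?opprB.
Qed.

(** Evaluation at the generators maps the model onto [G]. The model satisfies the relations, so it
    is in turn a quotient of [G]; comparing orders makes evaluation bijective. *)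
Lemma pauli_bij (G : finGroupType)
    (presG : ([set: G] \isog Grp (X : Y : Z :
       Z ^+ 4 = 1, Y ^+ 4 = 1, X ^+ 2 = 1,
       X * Z = Z^-1 * X, Z ^+ 2 = Y ^+ 2, X * Y = Y * X, Z * Y = Y * Z))%g) :
  exists2 h : pauli -> G, bijective h & {morph h : g k / (g * k)%g}.
Proof.
have /existsP[[[x y] z]] := isoGrp_hom presG; rewrite /= !xpair_eqE.
case/and5P=> /eqP genG _ /eqP y4 /eqP x2.
case/and4P=> /eqP xz /eqP zy /eqP xyC /eqP zyC.
have hM := pauli_evalM y4 x2 xz zy xyC zyC; set h := pauli_eval x y z in hM.
exists h => //.
have cardG : (#|{: pauli}| <= #|G|)%N.
  rewrite -[#|G|]cardsT -[#|{: pauli}|]cardsT; apply: leq_homg.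
  rewrite presG; pose x0 : pauli := (false, (false, (false, true))).
  pose y0 : pauli := (false, (true, (false, false))).
  pose z0 : pauli := (false, (false, (true, false))).
  apply/existsP; exists (x0, y0, z0).
  rewrite /= !xpair_eqE eqEsubset subsetT /= andbT; apply/subsetP=> g _.
  have -> : g = pauli_eval x0 y0 z0 g by move: g => [[] [[] [[] []]]].
  pose H := (<[x0]> <*> <[y0]> <*> <[z0]>)%G.
  change (pauli_eval x0 y0 z0 g \in gval H).
  have /andP[/andP[Hx Hy] Hz] :
      (x0 \in gval H) && (y0 \in gval H) && (z0 \in gval H).
    by rewrite -!cycle_subG -!join_subG subxx.
  by case: g => [p [q [r s]]]; rewrite !groupM ?groupX.
have h_surj (u : G) : u \in codom h.
  pose hm := Morphism (D := setT) (in2W hM).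
  have: u \in (hm @* setT)%g.
    have: u \in [set: G] by rewrite inE.
    apply/subsetP; rewrite -genG !join_subG !cycle_subG.
    rewrite -andbA; apply/and3P; split; apply/morphimP.
    - by exists ((false, (false, (false, true))) : pauli);
        rewrite ?inE //= !expg0 !mul1g.
    - by exists ((false, (true, (false, false))) : pauli);
        rewrite ?inE //= !expg0 !mul1g !mulg1.
    - by exists ((false, (false, (true, false))) : pauli);
        rewrite ?inE //= !expg0 !mul1g !mulg1.
  by case/morphimP=> g _ _ ->; apply: codom_f.
have h_inj : {in setT &, injective h}.
  apply/image_injP; rewrite eqn_leq leq_image_card cardsT (leq_trans cardG) //.
  apply/subset_leq_card/subsetP=> u _; case/codomP: (h_surj u) => g ->.
  exact: image_f.
apply: inj_card_bij => [u v|]; first exact: h_inj.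
rewrite -[leqRHS](_ : #|codom h| = _);
  last by apply: card_codom => u v; apply: h_inj.
by apply/subset_leq_card/subsetP=> u _.
Qed.

Lemma is_group_det_pauli (G : finGroupType)
    (presG : ([set: G] \isog Grp (X : Y : Z :
       Z ^+ 4 = 1, Y ^+ 4 = 1, X ^+ 2 = 1,
       X * Z = Z^-1 * X, Z ^+ 2 = Y ^+ 2, X * Y = Y * X, Z * Y = Y * Z))%g)
    (n : int) :
  is_group_det G n <-> exists a : pauli -> int, n = pauli_det a.
Proof.
have [h h_bij hM] := pauli_bij presG.
have h_one : h 1%g = 1%g by apply: (mulgI (h 1%g)); rewrite -hM !mulg1.
have h_inv g : h g^-1%g = (h g)^-1%g.
  by apply: (mulgI (h g)); rewrite -hM !mulgV.
have detE (a : {ffun G -> int}) : group_det a = pauli_det (a \o h).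
  rewrite -[LHS]/(detf (fun g k : G => a (g * k^-1)%g)) (detf_bij _ h_bij).
  rewrite -[RHS]detf_pauli; apply: eq_detf => g k /=; congr (a _).
  by rewrite -[pauli_mul _ _]/(g * k^-1)%g hM h_inv.
split=> [[a <-]|[a ->]]; first by exists (a \o h).
have [h' hK h'K] := h_bij.
exists [ffun g => a (h' g)]; rewrite detE -!detf_pauli.
by apply: eq_detf => g k /=; rewrite ffunE hK.
Qed.

(** * Even determinants: divisibility by 2^16 *)

Lemma dvdz_even (v : int) :
  (2 %| v)%Z -> ((if (4 %| v)%Z then 4 else 2) %| v)%Z.
Proof. by case: ifP. Qed.

Definition oddz (x : int) : bool := ~~ (2 %| x)%Z.

Lemma oddzD x y : oddz (x + y) = oddz x (+) oddz y.
Proof. rewrite /oddz; lia. Qed.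

Lemma oddzN x : oddz (- x) = oddz x.
Proof. rewrite /oddz; lia. Qed.

Lemma oddzB x y : oddz (x - y) = oddz x (+) oddz y.
Proof. by rewrite oddzD oddzN. Qed.

Lemma oddz2M x : oddz (2 * x) = false.
Proof. rewrite /oddz; lia. Qed.

Lemma oddzE x : exists k : int, x = 2 * k + oddz x.
Proof. exists (x %/ 2)%Z; rewrite /oddz; lia. Qed.

Lemma oddzM x y : oddz (x * y) = oddz x && oddz y.
Proof. by rewrite /oddz !dvdzE abszM !dvdn2 oddM !negbK. Qed.

Lemma sqr_mod4 x : exists k : int, x ^+ 2 = 4 * k + oddz x.
Proof.
have [k Ek] := oddzE x; exists (k ^+ 2 + k * oddz x).
have sqb : (oddz x : int) ^+ 2 = oddz x by case: oddz.
by rewrite {1}Ek sqrrD sqb; ring.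
Qed.

Lemma dvd4_sub (s f : int) : (2 %| s)%Z ->
  (4 %| s - 2 * f)%Z = ((4 %| s)%Z == (2 %| f)%Z).
Proof. lia. Qed.

(** These sum c over the elements where a coordinate character is -1; the value of that character is
    [total c] minus twice the sum. *)
Definition half_q (c : bool -> bool -> bool -> int) : int :=
  c true false false + c true false true + c true true false + c true true true.
Definition half_r (c : bool -> bool -> bool -> int) : int :=
  c false true false + c false true true + c true true false + c true true true.
Definition half_s (c : bool -> bool -> bool -> int) : int :=
  c false false true + c false true true + c true false true + c true true true.
Definition total (c : bool -> bool -> bool -> int) : int :=
  c false false false + c false false true + c false true false
  + c false true true + c true false false + c true false true
  + c true true false + c true true true.

(** The parities of [e] are orthogonal to all affine functions on (Z/2)^3, hence are themselves
    affine. Squares are parities mod 4, and the signed sum vanishes mod 4 for each of the 16 affine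
    functions. *)
Lemma spin_re_dvd4 e :
    ~~ oddz (total e) -> ~~ oddz (half_q e) -> ~~ oddz (half_r e) ->
  ~~ oddz (half_s e) -> (4 %| re_nrd e)%Z.
Proof.
rewrite /total /half_q /half_r /half_s /re_nrd !oddzD.
move: (e false false false) (e false false true) => e0 e1.
move: (e false true false) (e false true true) => e2 e3.
move: (e true false false) (e true false true) => e4 e5.
move: (e true true false) (e true true true) => e6 e7 {e}.
have [[k0 ->] [k1 ->]] := (sqr_mod4 e0, sqr_mod4 e1).
have [[k2 ->] [k3 ->]] := (sqr_mod4 e2, sqr_mod4 e3).
have [[k4 ->] [k5 ->]] := (sqr_mod4 e4, sqr_mod4 e5).
have [[k6 ->] [k7 ->]] := (sqr_mod4 e6, sqr_mod4 e7).
case: (oddz e0) (oddz e1) (oddz e2) (oddz e3) => [] [] [] [];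
  case: (oddz e4) (oddz e5) (oddz e6) (oddz e7) => [] [] [] [] //= _ _ _ _;
  lia.
Qed.

(** For affine parities, the products over q = 0 and 1 either vanish mod 2 or are affine in r and s;
    both have even sum. *)
Lemma spin_im_dvd4 e :
    ~~ oddz (total e) -> ~~ oddz (half_q e) -> ~~ oddz (half_r e) ->
  ~~ oddz (half_s e) -> (4 %| im_nrd e)%Z.
Proof.
rewrite /im_nrd (_ : 4 = 2 * 2) // dvdz_mul2l // -[(2 %| _)%Z]negbK -/(oddz _).
rewrite /total /half_q /half_r /half_s !(oddzB, oddzD, oddzM).
by do 8 case: (oddz (e _ _ _)).
Qed.

(** All eight character values are [s] minus twice a half-sum, and the half-sums are additive in the
    character mod 2. *)
Lemma c2cube_detE c :
  let fq := half_q c in let fr := half_r c in let fs := half_s c in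
  let s := total c in
  let frs := fr + fs - 2 * (c false true true + c true true true) in
  let fqs := fq + fs - 2 * (c true false true + c true true true) in
  let fqr := fq + fr - 2 * (c true true false + c true true true) in
  let fqrs := fqr + fs - 2 * (c false true true + c true false true) in
  c2cube_det c = (s - 2 * 0) * (s - 2 * fs) * (s - 2 * fr) * (s - 2 * frs)
    * ((s - 2 * fq) * (s - 2 * fqs) * (s - 2 * fqr) * (s - 2 * fqrs)).
Proof.
rewrite /= /c2cube_det /v4det /half_q /half_r /half_s /total.
by congr (_ * _ * _ * _ * (_ * _ * _ * _)); ring.
Qed.

(** Whether 4 divides a value depends on the parity of its half-sum. If some half-sum is odd, four
    values are divisible by 4 and the others by 2: 4^4 * 2^4 = 2^12. *)
Lemma c2cube_det_dvd c : (2 %| total c)%Z ->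
  ((if [&& ~~ oddz (half_q c), ~~ oddz (half_r c) & ~~ oddz (half_s c)]
    then 2 ^+ 8 else 2 ^+ 12)%R %| c2cube_det c)%Z.
Proof.
move=> s_even.
have dvd_v f :
    ((if (4 %| total c)%Z (+) oddz f then 4 else 2) %| total c - 2 * f)%Z.
  have -> : (4 %| total c)%Z (+) oddz f = (4 %| total c - 2 * f)%Z.
    by rewrite dvd4_sub // /oddz; do 2 case: (_ %| _)%Z.
  by apply: dvdz_even; rewrite rpredB ?dvdz_mulr.
have dvd_v4 f1 f2 f3 f4 :=
  dvdz_mul (dvdz_mul (dvdz_mul (dvd_v f1) (dvd_v f2)) (dvd_v f3)) (dvd_v f4).
rewrite c2cube_detE /=.
apply: dvdz_trans (dvdz_mul (dvd_v4 _ _ _ _) (dvd_v4 _ _ _ _)).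
move: (half_q c) (half_r c) (half_s c) (4 %| total c)%Z.
move=> fq fr fs b {s_even dvd_v dvd_v4}.
rewrite !oddzB !oddzD ?oddzN !oddz2M !addbF.
case: b (oddz fq) (oddz fr) (oddz fs) => [] [] [] [] /=; lia.
Qed.

Lemma oddz_lin a q r s : oddz (lin_coef a q r s) = oddz (spin_coef a q r s).
Proof. by rewrite /lin_coef /spin_coef oddzB oddzD. Qed.

Lemma oddz_c2cube_det c : oddz (c2cube_det c) = oddz (total c).
Proof.
have odd_v f : oddz (total c - 2 * f) = oddz (total c).
  by rewrite oddzB oddz2M addbF.
by rewrite c2cube_detE /= !oddzM !odd_v !andbb.
Qed.

Lemma oddz_sqr x : oddz (x ^+ 2) = oddz x.
Proof. by rewrite expr2 oddzM andbb. Qed.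

Lemma oddz_im_nrd e : oddz (im_nrd e) = false.
Proof. exact: oddz2M. Qed.

Lemma oddz_norm_nrd e : oddz (norm_nrd e) = oddz (total e).
Proof.
rewrite /norm_nrd oddzD !oddz_sqr oddz_im_nrd addbF /re_nrd /total.
rewrite !(oddzB, oddzD) !oddz_sqr.
by do 8 case: (oddz (e _ _ _)).
Qed.

Lemma lin_spin_parity a :
  [/\ oddz (total (lin_coef a)) = oddz (total (spin_coef a)),
      oddz (half_q (lin_coef a)) = oddz (half_q (spin_coef a)),
      oddz (half_r (lin_coef a)) = oddz (half_r (spin_coef a))
    & oddz (half_s (lin_coef a)) = oddz (half_s (spin_coef a))].
Proof.
have lin_spin F :
    F (lin_coef a) = F (spin_coef a) + 2 * F (pauli_coef a true) ->
    oddz (F (lin_coef a)) = oddz (F (spin_coef a)).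
  by move->; rewrite oddzD oddz2M addbF.
by split; apply: lin_spin;
  rewrite /total /half_q /half_r /half_s /lin_coef /spin_coef; ring.
Qed.

Lemma oddz_pauli_det a : oddz (pauli_det a) = oddz (total (lin_coef a)).
Proof.
have [total_parity _ _ _] := lin_spin_parity a.
rewrite /pauli_det oddzM oddz_sqr oddz_c2cube_det oddz_norm_nrd.
by rewrite -total_parity andbb.
Qed.

Lemma pauli_det_even (a : pauli -> int) :
  (2 %| pauli_det a)%Z -> ((2 ^+ 16)%R %| pauli_det a)%Z.
Proof.
move=> D_even; have s_even : (2 %| total (lin_coef a))%Z.
  by apply/negPn; rewrite -/(oddz _) -oddz_pauli_det /oddz negbK.
have [tE qE rE sE] := lin_spin_parity a.
have e_even : ~~ oddz (total (spin_coef a)) by rewrite -tE /oddz negbK.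
have := c2cube_det_dvd s_even; case: ifP => [/and3P[hq hr hs]|_] dvd_lin.
  (* Both parts of the reduced norm are divisible by 4, so 2^4 divides N and 2^8 divides N^2. *)
  rewrite (exprD 2 8 8) dvdz_mul // (exprM 2 4 2) dvdz_exp2r //.
  rewrite qE in hq; rewrite rE in hr; rewrite sE in hs.
  have dvd_re : (4 %| re_nrd (spin_coef a))%Z by apply: spin_re_dvd4.
  have dvd_im : (4 %| im_nrd (spin_coef a))%Z by apply: spin_im_dvd4.
  by rewrite (exprM 2 2 2) rpredD // dvdz_exp2r.
(* Here both parts are even, so 2^4 divides N^2. *)
rewrite (exprD 2 12 4) dvdz_mul // (exprM 2 2 2) dvdz_exp2r //.
have re_even : (2 %| re_nrd (spin_coef a))%Z.
  apply: contraLR e_even; rewrite negbK -oddz_norm_nrd -/(oddz _) => re_odd.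
  by rewrite /norm_nrd oddzD !oddz_sqr re_odd oddz_im_nrd.
by rewrite rpredD // dvdz_exp2r // dvdz_mulr.
Qed.

(** * Elements realising the required values *)

(* The entry of index 4q + 2r + s of t holds the coefficients of Y^q Z^r X^s
   and Y^(2+q) Z^r X^s; k and l weight the sum of all elements of the group and
   its twist by the character Y |-> -1, which change one factor each. *)
Definition table_elt (t : seq (int * int)) (k l : int) (g : pauli) : int :=
  let: (p, (q, (r, s))) := g in
  let uv := nth (0, 0) t (4 * q + 2 * r + s)%N in
  (if p then uv.2 else uv.1) + k + (-1) ^+ q * l.

Ltac unfold_pauli_det :=
  rewrite /pauli_det /c2cube_det /v4det /norm_nrd /re_nrd /im_nrd
    /lin_coef /spin_coef /pauli_coef /=.

Lemma det_1mod16 k : pauli_det (table_elt [:: (1, 0)] k 0) = 16 * k + 1.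
Proof. unfold_pauli_det; ring. Qed.

(** X + Z + ZX has value 3 at the two characters that [k] and [l] move, value -1 at the six others,
    and N = 1. *)
Lemma det_3mod16 k l :
  pauli_det (table_elt [:: (0, 0); (1, 0); (1, 0); (1, 0)] k l) =
  (16 * k + 3) * (16 * l + 3).
Proof. unfold_pauli_det; ring. Qed.

(** Adding 1 + Y^2 to X + Z + ZX raises every character value by 2 and fixes e. *)
Lemma det_5mod16 k l :
  pauli_det (table_elt [:: (1, 1); (1, 0); (1, 0); (1, 0)] k l) =
  (16 * k + 5) * (16 * l + 5).
Proof. unfold_pauli_det; ring. Qed.

(* Found by a search for elements with N = 4 for which the nontrivial
   characters of (Z/2)^3 have values multiplying to 2^10 or -2^10. *)
Lemma det_even0 k :
  pauli_det (table_elt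
    [:: (0, 0); (0, 0); (0, 0); (1, 0); (0, -1); (0, -1); (0, -1); (1, 1)]
    k 0) =
  2 ^+ 16 * (4 * - k).
Proof. unfold_pauli_det; ring. Qed.

Lemma det_even1 k :
  pauli_det (table_elt
    [:: (0, 0); (0, 0); (0, 0); (0, 0); (1, 0); (1, 1); (0, -1); (1, 1)] k 0) =
  2 ^+ 16 * (4 * k + 1).
Proof. unfold_pauli_det; ring. Qed.

Lemma det_even2 k :
  pauli_det (table_elt
    [:: (0, 0); (1, 0); (1, 0); (1, 0); (0, -1); (1, 1); (1, 1); (1, 1)] k 0) =
  2 ^+ 16 * (4 * k + 2).
Proof. unfold_pauli_det; ring. Qed.

Lemma det_even3 k :
  pauli_det (table_elt
    [:: (0, 0); (1, 0); (1, 0); (0, -1); (1, 0); (1, 1); (0, -1); (1, 0)] k 0) =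
  2 ^+ 16 * (4 * (- k - 1) + 3).
Proof. unfold_pauli_det; ring. Qed.

Lemma pauli_det_mul16 (m : int) : exists a, 2 ^+ 16 * m = pauli_det a.
Proof.
have Em : m = 4 * (m %/ 4)%Z + (m %% 4)%Z by rewrite {1}(divz_eq m 4) mulrC.
have m_ge0 : 0 <= (m %% 4)%Z by lia.
have m_lt4 : (m %% 4)%Z < 4 by lia.
rewrite Em; move: (m %/ 4)%Z (m %% 4)%Z m_ge0 m_lt4 => k.
case=> [[|[|[|[|i]]]]|i] // _ _.
- exists (table_elt
    [:: (0, 0); (0, 0); (0, 0); (1, 0); (0, -1); (0, -1); (0, -1); (1, 1)]
    (- k) 0).
  by rewrite det_even0 addr0 opprK.
- by eexists; rewrite -det_even1.
- by eexists; rewrite -det_even2.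
eexists; rewrite (_ : 4 * k + 3%N = 4 * (- (- k - 1) - 1) + 3); last by ring.
by rewrite -det_even3.
Qed.

Lemma pauli_det_1mod16 (n : int) :
  (n = 1 %[mod 16])%Z -> exists a, n = pauli_det a.
Proof.
move=> n1; exists (table_elt [:: (1, 0)] (n %/ 16)%Z 0).
by rewrite det_1mod16; lia.
Qed.

(** Up to sign [p] is a divisor that is 3 or 5 mod 16; as 3 * 3 and 5 * 5 are 9 mod 16, the cofactor
    lies in the same class. *)
Lemma pauli_det_9mod16 (n : int) (p : int) :
  (n = 9 %[mod 16])%Z -> (p %| n)%Z ->
  [\/ (p = 3 %[mod 16])%Z, (p = -3 %[mod 16])%Z,
      (p = 5 %[mod 16])%Z | (p = -5 %[mod 16])%Z] ->
  exists a, n = pauli_det a.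
Proof.
move=> n9 pn p_cond.
suff [d /dvdzP[m Em] d_mod] :
    exists2 d : int, (d %| n)%Z & (d = 3 %[mod 16])%Z \/ (d = 5 %[mod 16])%Z.
  set k := (d %/ 16)%Z; set l := (m %/ 16)%Z.
  case: d_mod => d_mod.
  - have dE : d = 16 * k + 3 by lia.
    have mE : m = 16 * l + 3 by rewrite Em dE in n9; lia.
    exists (table_elt [:: (0, 0); (1, 0); (1, 0); (1, 0)] l k).
    by rewrite det_3mod16 Em -mE -dE.
  - have dE : d = 16 * k + 5 by lia.
    have mE : m = 16 * l + 5 by rewrite Em dE in n9; lia.
    exists (table_elt [:: (1, 1); (1, 0); (1, 0); (1, 0)] l k).
    by rewrite det_5mod16 Em -mE -dE.
case: p_cond => p_mod; [exists p | exists (- p) | exists p | exists (- p)];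
  rewrite ?dvdzE ?abszN -?dvdzE //; move: p_mod; clear=> p_mod;
  [left | left | right | right]; lia.
Qed.

(** * Odd determinants: residues mod 16 *)

Lemma oddz_sqr_mod8 x : oddz x -> exists k : int, x ^+ 2 = 8 * k + 1.
Proof.
move=> x_odd; have [j Ej] := oddzE x; rewrite x_odd in Ej.
have [i Ei] := oddzE j; pose b : int := oddz j.
(* The witness is j (j + 1) / 2 with j = 2 i + b. *)
exists (2 * i ^+ 2 + (2 * b + 1) * i + b); rewrite Ej {1}Ei -/b.
by rewrite /b; case: oddz => /=; ring.
Qed.

(** [v4det] is the sum of the fourth powers, minus twice the products of two squares, plus 8 times
    the full product. Replacing x + y by x - y lowers a square by 4 x y; [S] and [E] are the
    resulting changes over 8 and 4. *)
Lemma v4det_mod8 (x y : bool -> bool -> int) :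
  exists K : int, v4det (fun r s => x r s + y r s) =
    v4det (fun r s => x r s - y r s) + 8 * K.
Proof.
pose d r s := x r s * y r s; pose p r s := x r s + y r s.
pose E i j k l := d k l * p i j ^+ 2 + d i j * p k l ^+ 2 - 4 * d i j * d k l.
pose S r s := d r s * (p r s ^+ 2 - 2 * d r s).
exists (S false false + S false true + S true false + S true true
  - (E false false false true + E false false true false
     + E false false true true + E false true true false
     + E false true true true + E true false true true)
  + p false false * p false true * p true false * p true true
  - (x false false - y false false) * (x false true - y false true)
    * (x true false - y true false) * (x true true - y true true)).
by rewrite /v4det /S /E /d /p; ring.
Qed.

Lemma c2cube_det_mod8 c :
  oddz (total c) -> exists j : int, c2cube_det c = 8 * j + 1.
Proof.
rewrite -oddz_c2cube_det /c2cube_det => D_odd.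
have [K EK] := v4det_mod8 (c false) (c true); rewrite EK.
rewrite oddzM in D_odd; case/andP: D_odd => _ /oddz_sqr_mod8[k Ek].
exists (k + K * v4det (fun r s => c false r s - c true r s)).
by rewrite mulrDl -expr2 Ek; ring.
Qed.

Lemma prod_1mod16 a b (x y : int) : x = 16 * a + 1 -> y = 16 * b + 1 ->
  exists2 e : int, x * y = 16 * e + 1 & oddz e = oddz a (+) oddz b.
Proof.
move=> -> ->; exists (2 * (8 * a * b) + (a + b)); first by ring.
by rewrite oddzD oddz2M oddzD.
Qed.

(** With v_i^2 = 16 w_i + 1, the sum of the w_i has the parity of [t], and D^2 is 1 plus 16 times
    that sum mod 32. *)
Lemma sqr_prod8_mod32 (v0 v1 v2 v3 v4 v5 v6 v7 t : int)
    (D := v0 * v1 * v2 * v3 * (v4 * v5 * v6 * v7)) :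
  (forall d : int, (d %| D)%Z -> exists w : int, d ^+ 2 = 16 * w + 1) ->
  v0 ^+ 2 + v1 ^+ 2 + v2 ^+ 2 + v3 ^+ 2
    - (v4 ^+ 2 + v5 ^+ 2 + v6 ^+ 2 + v7 ^+ 2) = 16 * t ->
  ~~ oddz t -> exists k : int, D ^+ 2 = 32 * k + 1.
Proof.
move=> D_div sum_sqr t_even.
have [|w0 E0] := D_div v0; first by rewrite /D -!mulrA dvdz_mulr.
have [|w1 E1] := D_div v1; first by rewrite /D (mulrC v0) -!mulrA dvdz_mulr.
have [|w2 E2] := D_div v2; first by rewrite /D (mulrC _ v2) -!mulrA dvdz_mulr.
have [|w3 E3] := D_div v3; first by rewrite /D (mulrC _ v3) -!mulrA dvdz_mulr.
have [|w4 E4] := D_div v4; first by rewrite /D dvdz_mull // -!mulrA dvdz_mulr.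
have [|w5 E5] := D_div v5;
  first by rewrite /D dvdz_mull // (mulrC v4) -!mulrA dvdz_mulr.
have [|w6 E6] := D_div v6;
  first by rewrite /D dvdz_mull // (mulrC _ v6) -!mulrA dvdz_mulr.
have [|w7 E7] := D_div v7; first by rewrite /D dvdz_mull // dvdz_mull.
have [a1 F1 P1] := prod_1mod16 E0 E1.
have [a2 F2 P2] := prod_1mod16 F1 E2.
have [a3 F3 P3] := prod_1mod16 F2 E3.
have [a4 F4 P4] := prod_1mod16 E4 E5.
have [a5 F5 P5] := prod_1mod16 F4 E6.
have [a6 F6 P6] := prod_1mod16 F5 E7.
have [a7 F7 P7] := prod_1mod16 F3 F6.
have Et : t = w0 + w1 + w2 + w3 - (w4 + w5 + w6 + w7).
  by move: sum_sqr; rewrite E0 E1 E2 E3 E4 E5 E6 E7; clear; lia.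
have : ~~ oddz a7.
  by move: t_even; rewrite P7 P6 P5 P4 P3 P2 P1 Et oddzB !oddzD.
have [k Ek] := oddzE a7 => /negPf a7_even; exists k.
by rewrite /D !exprMn F7 Ek a7_even /=; ring.
Qed.

Lemma c2cube_det_mod16 c :
  (forall d : int, (d %| c2cube_det c)%Z ->
    exists w : int, d ^+ 2 = 16 * w + 1) ->
  oddz (total c) ->
  ~~ oddz (c false false false * c true false false
    + c false false true * c true false true
    + c false true false * c true true false
    + c false true true * c true true true) ->
  exists j : int, c2cube_det c = 16 * j + 1.
Proof.
move=> D_div c_odd t_even; have [j Ej] := c2cube_det_mod8 c_odd.
have [k Ek] : exists k : int, c2cube_det c ^+ 2 = 32 * k + 1.
  (* By Parseval on (Z/2)^2, the signed sum of squares is 4 times the sum of (c0 + c1)^2 - (c0 -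
     c1)^2, which is 16 times that of c0 c1. *)
  rewrite c2cube_detE in D_div *; apply: sqr_prod8_mod32 D_div _ t_even.
  by rewrite /total /half_q /half_r /half_s; ring.
exists (j %/ 2)%Z; rewrite Ej in Ek *; move: Ek; clear; lia.
Qed.

Lemma mod8_or_prime (m : nat) : odd m ->
  ((m %% 8 == 1) || (m %% 8 == 7))%N \/
  exists p, [/\ prime p, (p %| m)%N & (p %% 8 == 3) || (p %% 8 == 5)]%N.
Proof.
elim/ltn_ind: m => m IH m_odd.
have [m1|m_gt1] := leqP m 1; first by left; case: m m1 m_odd IH => [|[]].
have p_pr := pdiv_prime m_gt1; have p_dvd := pdiv_dvd m.
have /dvdnP[k Em] := p_dvd.
move: (pdiv m) p_pr p_dvd Em => p p_pr p_dvd Em.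
have /andP[k_odd p_odd] : odd k && odd p by rewrite -oddM -Em.
have [p35|p17] := boolP ((p %% 8 == 3) || (p %% 8 == 5))%N.
  by right; exists p.
have [|k17|[r [r_pr r_dvd r35]]] := IH k _ k_odd.
- rewrite Em ltn_Pmulr ?prime_gt1 //; by case: k k_odd {Em}.
- left; rewrite Em -modnMm.
  have {p17} p17 : ((p %% 8 == 1) || (p %% 8 == 7))%N by lia.
  by case/orP: k17 => /eqP ->; case/orP: p17 => /eqP ->.
by right; exists r; split=> //; rewrite Em dvdn_mulr.
Qed.

(** [N] is nonnegative and 1 + 4 y^2 mod 8, so 1 or 5; the hypothesis excludes 5. *)
Lemma sum_sqr_mod8 (x y : int) (N := x ^+ 2 + (2 * y) ^+ 2) :
  oddz x -> ((`|N| %% 8 == 1) || (`|N| %% 8 == 7))%N ->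
  ~~ oddz y /\ exists m : int, N = 8 * m + 1.
Proof.
move=> /oddz_sqr_mod8[k Ek]; have N_ge0 : 0 <= N by rewrite addr_ge0 ?sqr_ge0.
have [l El] := sqr_mod4 y; rewrite /N exprMn Ek El in N_ge0 *.
case: (oddz y) => /= in N_ge0 *; first by move: N_ge0; clear; lia.
by split=> //; exists (k + 2 * l); ring.
Qed.

Lemma pauli_det_odd_spec a : oddz (pauli_det a) ->
  (pauli_det a = 1 %[mod 16])%Z \/
  (pauli_det a = 9 %[mod 16])%Z /\
  exists p : nat,
    [/\ prime p,
       [\/ (p = 3 %[mod 16])%Z, (p = -3 %[mod 16])%Z,
           (p = 5 %[mod 16])%Z | (p = -5 %[mod 16])%Z]
     & (p %| pauli_det a)%Z].
Proof.
move=> D_odd; have c_odd : oddz (total (lin_coef a)) by rewrite -oddz_pauli_det.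
have N_odd : oddz (norm_nrd (spin_coef a)).
  by move: D_odd; rewrite /pauli_det oddzM oddz_sqr => /andP[].
have [i Ei] := c2cube_det_mod8 c_odd; have [k Ek] := oddz_sqr_mod8 N_odd.
have [p_ex|no_p] := boolP (has (fun p => (p %% 8 == 3) || (p %% 8 == 5))%N
    (primes `|pauli_det a|)).
  have D_mod : (pauli_det a = 1 %[mod 16])%Z \/ (pauli_det a = 9 %[mod 16])%Z.
    by rewrite /pauli_det Ei Ek; clear; lia.
  case: D_mod => D_mod; [by left | right; split=> //].
  have /hasP[p] := p_ex; rewrite mem_primes => /and3P[p_pr _ p_dvd] p_mod.
  exists p; split=> //; move: p_mod; clear => p_mod.
  have : [|| p %% 16 == 3, p %% 16 == 13, p %% 16 == 5 | p %% 16 == 11]%N.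
    by lia.
  by case/or4P=> /eqP p16;
    [constructor 1 | constructor 2 | constructor 3 | constructor 4]; lia.
have D_div d :
    (d %| pauli_det a)%Z -> (`|d| %% 8 == 1)%N || (`|d| %% 8 == 7)%N.
  move=> d_dvd; have d_odd : odd `|d|%N.
    move: D_odd; have [m ->] := dvdzP d_dvd.
    by rewrite oddzM /oddz !dvdzE !dvdn2 !negbK => /andP[].
  have [//|[p [p_pr p_dvd p_mod]]] := mod8_or_prime d_odd.
  case/hasP: no_p; exists p => //; rewrite mem_primes p_pr absz_gt0.
  rewrite (dvdn_trans p_dvd) // andbT.
  by apply: contraTneq D_odd => ->.
have D_div_sqr d : (d %| pauli_det a)%Z -> exists w : int, d ^+ 2 = 16 * w + 1.
  move=> /D_div d_mod.
  have [l [El|El]] : exists l, d = 8 * l + 1 \/ d = 8 * l - 1.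
  - exists ((d + 1) %/ 8)%Z; move: d_mod; clear; lia.
  - by exists (4 * l ^+ 2 + l); rewrite El; ring.
  - by exists (4 * l ^+ 2 - l); rewrite El; ring.
have re_odd : oddz (re_nrd (spin_coef a)).
  by move: N_odd; rewrite /norm_nrd oddzD !oddz_sqr oddz_im_nrd addbF.
have [|t_even [m Em]] := sum_sqr_mod8 re_odd (D_div (norm_nrd (spin_coef a)) _).
  by rewrite /pauli_det expr2 mulrA dvdz_mull.
left; have [d d_dvd|||j Ej] := @c2cube_det_mod16 (lin_coef a).
- by apply: D_div_sqr; rewrite dvdz_mulr.
- by [].
(* As c and e agree mod 2, evenness of half the imaginary part passes to the sum of c0 c1. *)
- apply: contra t_even; have := oddz_lin a; move: (lin_coef a) (spin_coef a).
  by move=> c e ce; rewrite !(oddzD, oddzN, oddzM) !ce.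
(* Since N = 8 m + 1, its square is 1 mod 16. *)
rewrite /pauli_det Ej -[norm_nrd _]/(_ + _) Em.
rewrite (_ : _ * _ = 16 * (j * (8 * m + 1) ^+ 2 + 4 * m ^+ 2 + m) + 1);
  last by ring.
by rewrite mulrC modzMDl.
Qed.

Local Close Scope ring_scope.

Theorem theorem1p1 (G : finGroupType)
    (presG : ([set: G] \isog Grp (X : Y : Z :
       Z ^+ 4 = 1, Y ^+ 4 = 1, X ^+ 2 = 1,
       X * Z = Z^-1 * X, Z ^+ 2 = Y ^+ 2, X * Y = Y * X, Z * Y = Y * Z))%g) :
  (forall n : int,
     is_group_det G n /\ (2 %| n)%Z <-> ((2 ^+ 16)%R %| n)%Z) /\
  (forall n : int,
     is_group_det G n /\ ~~ (2 %| n)%Z <->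
       (n = 1 %[mod 16])%Z \/
       (n = 9 %[mod 16])%Z /\
       exists p : nat,
         [/\ prime p,
             [\/ (p = 3 %[mod 16])%Z, (p = -3 %[mod 16])%Z,
                 (p = 5 %[mod 16])%Z | (p = -5 %[mod 16])%Z]
           & (p %| n)%Z]).
Proof.
have detP := is_group_det_pauli presG.
split=> n; split.
- by case=> /detP[a ->]; apply: pauli_det_even.
- case/dvdzP=> m ->; split; last by rewrite dvdz_mull.
  by apply/detP; have [a Ea] := pauli_det_mul16 m; exists a; rewrite -Ea mulrC.
- by case=> /detP[a ->]; apply: pauli_det_odd_spec.
case=> [n1|[n9 [p [_ p_mod p_dvd]]]]; split.
- by apply/detP; apply: pauli_det_1mod16.
- by move: n1; clear; lia.
- by apply/detP; apply: pauli_det_9mod16 p_dvd p_mod.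
- by move: n9; clear; lia.
Qed.
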